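(* Let $n\in\mathbf{N}$, let $X,Y,Z$ be Banach spaces, $U\subset X$, $V\subset Y$, and let $f:U\to Y$, $g:V\to Z$ be such that $f(U)\subset V$. Let $x\in U^o$ (the interior of $U$) be such that the strict derivatives $f^{(k)}(x)$, $0\le k\le n$, exist, $f(x)\in V$, and the strict derivatives $g^{(k)}(f(x))$, $0\le k\le n$, exist. Then the strict derivative $(g\circ f)^{(n)}(x)$ exists and, for a set $I$ with $|I|=n$ and all $v_i\in X$ ($i\in I$), $$\left\langle (g\circ f)^{(n)}(x),\bigotimes_{i\in I} v_i\right\rangle=\sum_{\pi\in\mathcal{H}(I)}\left\langle g^{(|\pi|)}(f(x)),\bigotimes_{S\in\pi}\left\langle f^{(|S|)}(x),\bigotimes_{i\in S}v_i\right\rangle\right\rangle .$$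
   Context: $\mathbf{N}$ is the set of non-negative integers; $|I|$ is the cardinality of a finite set $I$. The scalar field is $\mathbf{R}$ or $\mathbf{C}$ (the same for all spaces). $\mathcal{H}(I)$ is the set of partitions of $I$: the collections $\pi$ of pairwise disjoint non-empty subsets of $I$ whose union is $I$. In particular $\mathcal{H}(\emptyset)=\{\emptyset\}$. Symmetric powers: $S^n(X)$ is the quotient of the $n$-fold algebraic tensor product of $X$ by the span of all $x_1\otimes\dots\otimes x_n-x_{\sigma(1)}\otimes\dots\otimes x_{\sigma(n)}$, $\sigma$ a permutation; $S^0(X)$ is the scalar field. The image of $x_1\otimes\dots\otimes x_n$ in $S^n(X)$ is denoted by the same symbol, so $\bigotimes_{i\in I}x_i\in S^{|I|}(X)$ makes sense for any finite family. $\mathcal{L}^{(n)}(X,Y)$ is the Banach space of bounded linear operators $T:S^n(X)\to Y$, i.e. those with $\|T\|:=\sup_{\|x_i\|\le1}\|\langle T,x_1\otimes\dots\otimes x_n\rangle\|<\infty$ (equivalently, bounded symmetric $n$-linear operators $X^n\to Y$); $\langle T,\cdot\rangle$ denotes evaluation of $T$. Strict $n$-th (Fréchet) derivative: let $X,Y$ be Banach spaces, $U\subset X$, $f:U\to Y$, $x\in U^o$ (the interior of $U$), $n\in\mathbf{N}$. One says that $f$ has a strict $n$-th derivative at $x$, equal to $f^{(n)}(x)\in\mathcal{L}^{(n)}(X,Y)$, if for a set $I$ with $|I|=n$ $$\sum_{S\subset I}(-1)^{|I|-|S|}f\Bigl(\bar v+\sum_{i\in S}v_i\Bigr)=\Bigl\langle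 f^{(n)}(x),\bigotimes_{i\in I}v_i\Bigr\rangle+o\Bigl(\prod_{i\in I}\|v_i\|\Bigr)\quad\text{as }\bar v\to x,\ v_i\to0\ (i\in I),$$ where $\bar v, v_i\in X$, and where the $o$ means: for every $\varepsilon>0$ there is $\delta>0$ such that the remainder has norm at most $\varepsilon\prod_{i\in I}\|v_i\|$ whenever $\|\bar v-x\|<\delta$ and $\|v_i\|<\delta$ for all $i\in I$. Such $f^{(n)}(x)$ is unique if it exists. For $n=0$, $f^{(0)}(x)=y$ means that $f$ is continuous at $x$ and $f(x)=y$. No existence of derivatives at points other than the given point is assumed. Existence of $g^{(k)}(f(x))$ in this sense presupposes that $f(x)$ is an interior point of $V$. *)

(* Defs.v *)
From HB Require Import structures.
From mathcomp Require Import all_boot all_order all_algebra perm.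
From mathcomp Require Import complex.
From mathcomp Require Import all_classical all_reals topology normedtype.

Set Implicit Arguments.
Unset Strict Implicit.
Unset Printing Implicit Defensive.

Import Order.TTheory GRing.Theory Num.Theory.
Import numFieldNormedType.Exports.

Local Open Scope classical_set_scope.
Local Open Scope ring_scope.

Variant scalar_kind := RealScalars | ComplexScalars.

(* The field of real or of complex numbers. The norm of a [normedModType] over
   [R[i]] takes its values in [R[i]], whose order only relates numbers with the
   same imaginary part; hence [0 < e] below means that [e] is real and positive,
   and a bound [`|u| <= M] forces [M] to be real. *)
Definition scalars (R : realType) (k : scalar_kind) : numFieldType :=
  match k with
  | RealScalars => R : numFieldType
  | ComplexScalars => R[i] : numFieldType
  end.

(* A bounded linear operator from the n-th symmetric power of X to Y, presented
   as the bounded symmetric n-linear operator that is its composition with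
   (x_1, ..., x_n) |-> x_1 (x) ... (x) x_n. For n = 0 it is an element of Y. *)
Record symop (K : numFieldType) (n : nat) (X Y : normedModType K) := SymOp {
  symop_fun :> ('I_n -> X) -> Y;
  symop_linear : forall (v : 'I_n -> X) (i : 'I_n),
    linear (fun u : X => symop_fun (dfwith v i u));
  symop_sym : forall (s : 'S_n) (v : 'I_n -> X),
    symop_fun (v \o s) = symop_fun v;
  symop_bounded : exists M : K, forall v : 'I_n -> X,
    (forall i, `|v i| <= 1) -> `|symop_fun v| <= M }.

(* < T, (x)_(i in A) v_i > for an unordered finite family: by symmetry of T the
   enumeration of A is irrelevant. *)
Definition sym_eval (K : numFieldType) (n : nat) (X Y : normedModType K)
    (T : symop n X Y) (I : finType) (A : {set I}) (cardA : #|A| = n)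
    (v : I -> X) : Y :=
  T (fun j : 'I_n => v (enum_val (cast_ord (esym cardA) j))).

(* T is the strict n-th derivative at x of f : U -> Y. The map f is represented
   by a total function; since x is interior to U, the values outside U do not
   matter, because for small delta all the points involved are in U. *)
Definition is_strict_derivative (K : numFieldType) (X Y : normedModType K)
    (U : set X) (f : X -> Y) (x : X) (n : nat) (T : symop n X Y) : Prop :=
  U° x /\
  forall e : K, 0 < e -> exists2 d : K, 0 < d &
    forall (vbar : X) (v : 'I_n -> X),
      `|vbar - x| < d -> (forall i, `|v i| < d) ->
      `|\sum_(S : {set 'I_n})
           (-1) ^+ (n - #|S|) *: f (vbar + \sum_(i in S) v i) - T v|
        <= e * \prod_(i < n) `|v i|.

(* Main.v *)
Require Import Defs.
From HB Require Import structures.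
From mathcomp Require Import all_boot all_order all_algebra perm.
From mathcomp Require Import complex.
From mathcomp Require Import all_classical all_reals topology normedtype.

(** The [n]-th difference of [g \o f] at [w] with steps [v i] is an alternating
    sum of the values of [g] at the points [f (w + \sum_(i in S) v i)]. By
    Moebius inversion such a point is [f w] plus the sum of the increments
    [y T], the differences of [f] at [w] along the non-empty subsets [T] of [S].
    Hence each value of [g] is in turn a sum of differences of [g] at [f w] with
    the increments [y T] as steps, one for each family [B] of non-empty subsets
    of [S], and the alternating sum over [S] keeps exactly those families that
    cover the whole index set [I] ([diff_comp]):

      diff (g \o f) I w v = \sum_(B covers I) diff g B (f w) y.

    The strict derivatives of [f] give [y T = <Df, v_T> + o(\prod_(i in T) |v i|)],
    so [y T] is [O] of the same product and the steps [y T] tend to [0]. It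
    remains to compare each term with [\prod_i |v i|], the product of all steps.
    - If [B] is a partition, it has at most [n] blocks, and the strict derivative
      of [g] of order [#|B|] gives the term of the formula indexed by [B]
      ([partition_negligible]).
    - If [B] has at most [n] sets, two of which share a point [i], the difference
      is [O] of the product over [B] of the products of steps, in which [v i]
      occurs twice: the term is [o(\prod_i |v i|)] ([overlap_negligible]).
    - If [B] has more than [n] sets, no derivative of [g] of order [#|B|] is at
      hand. But some [B'] in [B] with at most [n] sets already covers [I], and
      the difference along [B] is an alternating sum of differences along [B']
      at translated base points. A strict derivative has the same main term at
      all nearby base points, so the main terms cancel and only the remainders,
      [o(\prod_(T in B') |y T|)], are left ([diff_proper_negligible],
      [excess_negligible]). This is where strictness of the derivatives of [g]
      is essential.

    The sum over partitions is linear in each [v i] because [i] lies in exactly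
    one block, and it is symmetric because relabelling [I] permutes the
    partitions of [I]. *)

Set Implicit Arguments.
Unset Strict Implicit.
Unset Printing Implicit Defensive.

Import Order.TTheory GRing.Theory Num.Theory.
Import numFieldNormedType.Exports.

Local Open Scope classical_set_scope.
Local Open Scope ring_scope.

(** * Alternating sums over subsets *)

Section AlternatingSums.
Import boot.fintype boot.finset.
Variables (K : pzRingType) (I : finType).
Implicit Types (A S T : {set I}).

Lemma sum_subsetU1 (V : nmodType) (F : {set I} -> V) (a : I) A :
  a \notin A ->
  \sum_(S : {set I} | S \subset a |: A) F S =
    \sum_(S : {set I} | S \subset A) F S +
    \sum_(S : {set I} | S \subset A) F (a |: S).
Proof.
move=> aA; rewrite (bigID (fun S => a \in S)) /= addrC; congr (_ + _).
  apply: eq_bigl => S; apply/andP/idP => [[SA aS]|SA].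
    by rewrite -(setU1K aA) subsetD1 SA.
  split; first exact: subset_trans SA (subsetUr _ _).
  by apply: contra aA; apply: (subsetP SA).
rewrite (reindex_onto (fun S => a |: S) (fun S => S :\ a)) /=; last first.
  by move=> S /andP[_ aS]; rewrite setD1K.
apply: eq_bigl => S; rewrite setU11 andbT; apply/andP/idP.
  move=> [SA /eqP <-].
  by rewrite -(setU1K aA); apply: setSD.
move=> SA; split; first exact: setUS.
by rewrite setU1K //; apply: contra aA; apply: (subsetP SA).
Qed.

Definition altsum (Y : lmodType K) (G : {set I} -> Y) A : Y :=
  \sum_(S : {set I} | S \subset A) (-1) ^+ #|A :\: S| *: G S.

Lemma altsumU1 (Y : lmodType K) (G : {set I} -> Y) (a : I) A :
  a \notin A ->
  altsum G (a |: A) = altsum (fun S => G (a |: S)) A - altsum G A.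
Proof.
move=> aA; rewrite /altsum sum_subsetU1 // addrC -sumrN; congr (_ + _).
  apply: eq_bigr => S SA; congr (_ ^+ _ *: _); congr #|pred_of_set _|.
  apply/setP=> i.
  by rewrite !inE; case: eqVneq => //= ->; rewrite (negbTE aA) andbF.
apply: eq_bigr => S SA.
have aS : a \notin S by apply: contra aA; apply: (subsetP SA).
rewrite -scaleNr -[- (_ ^+ _)]mulN1r -exprS; congr (_ ^+ _ *: _).
have -> : (a |: A) :\: S = a |: (A :\: S).
  apply/setP=> i; rewrite !inE; case: eqVneq => //= ->; by rewrite aS.
by rewrite cardsU1 inE (negbTE aA) andbF.
Qed.

Lemma set_altsum (Y : lmodType K) (G G' : {set I} -> Y) A :
  (forall S, S \subset A -> G S = G' S) -> altsum G A = altsum G' A.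
Proof. by move=> GG'; apply: eq_bigr => S SA; rewrite GG'. Qed.

Lemma altsum_sum (Y : lmodType K) (J : finType) (P : pred J)
    (G : J -> {set I} -> Y) A :
  altsum (fun S => \sum_(j | P j) G j S) A = \sum_(j | P j) altsum (G j) A.
Proof.
by rewrite exchange_big; apply: eq_bigr => S _; rewrite scaler_sumr.
Qed.

(** A point of [A] outside [T] can be inserted in [S] or removed from it without
    affecting the indicator, so by [altsumU1] the sum is a difference of two
    equal terms. *)
Lemma altsum_indicator (Y : lmodType K) (y : Y) T A :
  altsum (fun S => if T \subset S then y else 0) A = if T == A then y else 0.
Proof.
have [TA|nTA] := boolP (T \subset A); last first.
  rewrite /altsum big1 => [|S SA].
    by case: eqVneq nTA => // ->; rewrite subxx.
  by rewrite ifN ?scaler0 //; apply: contra nTA => /subset_trans; apply.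
have [->|nTA] := eqVneq T A.
  rewrite /altsum (bigD1 A) //= subxx setDv cards0 expr0 scale1r.
  rewrite big1 ?addr0 // => S /andP[SA nSA].
  by rewrite ifN ?scaler0 //; apply: contra nSA => AS; rewrite eqEsubset SA.
have /properP[_ [a aA aT]] : T \proper A by rewrite properEneq nTA.
rewrite -[A in LHS](setD1K aA) altsumU1 ?setD11 //.
apply/eqP; rewrite subr_eq0; apply/eqP; apply: eq_bigr => S _.
have TD : T :\: [set a] = T by apply/setDidPl; rewrite disjoint_sym disjoints1.
by rewrite -{2}TD subDset.
Qed.


(** Moebius inversion on the lattice of subsets of [A]. *)
Lemma sum_altsum (Y : lmodType K) (G : {set I} -> Y) A :
  \sum_(S : {set I} | S \subset A) altsum G S = G A.
Proof.
have [m] := ubnP #|A|; elim: m => // m IHm in A G *.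
have [->|[a aA]] := set_0Vmem A => ltAm.
  rewrite (eq_bigl (pred1 set0)) => [|S]; last exact: subset0.
  rewrite big_pred1_eq /altsum (eq_bigl (pred1 set0)) => [|S].
    by rewrite big_pred1_eq set0D cards0 expr0 scale1r.
  exact: subset0.
have aDA : a \notin A :\ a by rewrite setD11.
rewrite -(setD1K aA) sum_subsetU1 // -big_split /=.
under eq_bigr => S SA.
  rewrite altsumU1 1?addrC ?subrK; first over.
  by apply: contra aDA; apply: (subsetP SA).
rewrite (IHm _ (fun S => G (a |: S))) //.
by rewrite (cardsD1 a) aA in ltAm.
Qed.
End AlternatingSums.

(** * Finite differences *)

Section Differences.
Import boot.fintype boot.finset.
Variables (K : pzRingType).

Definition diff (X : zmodType) (Y : lmodType K) (I : finType) (f : X -> Y)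
    (A : {set I}) (w : X) (v : I -> X) : Y :=
  altsum (fun S => f (w + \sum_(i in S) v i)) A.

Lemma diff0 (X : zmodType) (Y : lmodType K) (I : finType) (f : X -> Y) w
    (v : I -> X) : diff f set0 w v = f w.
Proof.
have := sum_altsum (fun S => f (w + \sum_(i in S) v i)) set0.
rewrite (eq_bigl (pred1 set0)) => [|S]; last exact: subset0.
by rewrite big_pred1_eq big_set0 addr0.
Qed.

Lemma diffU1 (X : zmodType) (Y : lmodType K) (I : finType) (f : X -> Y)
    (a : I) (A : {set I}) w v :
  a \notin A -> diff f (a |: A) w v = diff f A (w + v a) v - diff f A w v.
Proof.
move=> aA; rewrite /diff altsumU1 //; congr (_ - _).
apply: set_altsum => S SA; rewrite big_setU1 ?addrA //.
by apply: contra aA; apply: (subsetP SA).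
Qed.

(** The difference along the empty set is the value [f w] and does not tend to
    [0]; replacing it by [0] makes all the increments small. *)
Definition increments (X : zmodType) (Y : lmodType K) (I : finType)
    (f : X -> Y) (w : X) (v : I -> X) (T : {set I}) : Y :=
  if T == set0 then 0 else diff f T w v.

Lemma sum_increments (X : zmodType) (Y : lmodType K) (I : finType)
    (f : X -> Y) (w : X) (v : I -> X) (S : {set I}) :
  f (w + \sum_(i in S) v i) =
    f w + \sum_(T in powerset S :\ set0) increments f w v T.
Proof.
rewrite -[LHS](sum_altsum (fun S => f (w + \sum_(i in S) v i)) S).
rewrite (bigD1 set0) ?sub0set //= -/(diff _ _ _ _) diff0; congr (_ + _).
rewrite [RHS](eq_bigl (fun T : {set I} => (T \subset S) && (T != set0))) => [|T].
  by apply: eq_bigr => T /andP[_ /negbTE T0]; rewrite /increments T0.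
by rewrite !inE andbC.
Qed.

(** Expand every value of [g \o f] by [sum_increments] and [sum_altsum] as a
    sum of differences of [g] along families [B] of subsets of [S]; the
    alternating sum over [S] keeps the families that cover [A]. *)
Lemma diff_comp (X : zmodType) (Y Z : lmodType K) (I : finType)
    (f : X -> Y) (g : Y -> Z) (A : {set I}) w v :
  diff (g \o f) A w v =
    \sum_(B : {set {set I}} | (set0 \notin B) && (cover B == A))
      diff g B (f w) (increments f w v).
Proof.
set y := increments f w v.
rewrite {1}/diff.
rewrite (@set_altsum _ _ _ _ (fun S => \sum_(B : {set {set I}} | set0 \notin B)
  if cover B \subset S then diff g B (f w) y else 0)) => [|S _].
  rewrite altsum_sum [RHS]big_mkcondr; apply: eq_bigr => B _.
  exact: altsum_indicator.
rewrite /= sum_increments.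
rewrite -(sum_altsum (fun C => g (f w + \sum_(T in C) y T))) -big_mkcondr /=.
apply: eq_bigl => B; rewrite subsetD1 andbC; congr (_ && _).
apply/subsetP/bigcupsP => BS T TB; first by have := BS T TB; rewrite inE.
by rewrite inE; apply: BS.
Qed.

End Differences.

(** * Multilinear evaluation along a finite set *)

Section Evaluation.
Import boot.fintype boot.finset.
Variables (K : numFieldType) (X Y : normedModType K).
Variable (T : forall k, symop k X Y).
Implicit Types (I J : finType).

Definition teval I (A : {set I}) (v : I -> X) : Y :=
  sym_eval (T #|A|) (erefl #|A|) v.

Lemma tevalE I (A : {set I}) v : teval A v = T #|A| (fun j => v (enum_val j)).
Proof.
by rewrite /teval /sym_eval; congr (T _ _); apply/funext => j; rewrite cast_ord_id.
Qed.

Lemma eq_teval I (A : {set I}) (v v' : I -> X) :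
  {in A, v =1 v'} -> teval A v = teval A v'.
Proof.
move=> vv'; rewrite !tevalE; congr (T _ _); apply/funext => j.
by rewrite vv' ?enum_valP.
Qed.

(** Two enumerations of [A] differ by a permutation. *)
Lemma sym_eval_enum n (S : symop n X Y) I (A : {set I}) (cardA : #|A| = n)
    (e : 'I_n -> I) (v : I -> X) :
  injective e -> (forall j, e j \in A) ->
  sym_eval S cardA v = S (fun j => v (e j)).
Proof.
move=> e_inj eA.
pose r j := cast_ord cardA (enum_rank_in (eA j) (e j)).
have rK j : enum_val (cast_ord (esym cardA) (r j)) = e j.
  by rewrite /r cast_ordK enum_rankK_in.
have r_inj : injective r.
  move=> j j' /(congr1 (fun i => enum_val (cast_ord (esym cardA) i))).
  by rewrite !rK => /e_inj.
rewrite /sym_eval -(symop_sym _ (perm r_inj)); congr (S _); apply/funext => j.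
by rewrite /= permE -[in RHS]rK.
Qed.
Lemma teval_card I (A : {set I}) n (cardA : #|A| = n) v :
  sym_eval (T n) cardA v = teval A v.
Proof. by case: n / cardA. Qed.


Lemma teval_imset I J (h : J -> I) (A : {set J}) (v : I -> X) :
  injective h -> teval (h @: A) v = teval A (v \o h).
Proof.
move=> h_inj; have cardA := card_imset (mem A) h_inj.
rewrite -(teval_card cardA) (@sym_eval_enum _ _ _ _ _ (h \o enum_val)).
- by rewrite tevalE.
- exact/inj_comp/enum_val_inj.
- by move=> j /=; rewrite imset_f ?enum_valP.
Qed.

Lemma teval_linear I (A : {set I}) (i : I) (v : I -> X) :
  i \in A -> linear (fun u => teval A (dfwith v i u)).
Proof.
move=> iA a u u'; rewrite !tevalE; pose j := enum_rank_in iA i.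
have ij t : (fun k : 'I_#|A| => dfwith v i t (enum_val k)) =
            dfwith (fun k : 'I_#|A| => v (enum_val k)) j t.
  apply/funext => k; have [<-|jk] := eqVneq j k.
    by rewrite dfwithin enum_rankK_in ?dfwithin.
  rewrite !dfwithout //; apply: contra jk => /eqP ik.
  by apply/eqP/enum_val_inj; rewrite enum_rankK_in.
by rewrite !ij symop_linear.
Qed.

Lemma tevalB I (A : {set I}) (i : I) (v : I -> X) u u' : i \in A ->
  teval A (dfwith v i (u - u')) = teval A (dfwith v i u) - teval A (dfwith v i u').
Proof.
move=> iA; have -> : u - u' = -1 *: u' + u by rewrite scaleN1r addrC.
by rewrite (teval_linear v iA) scaleN1r addrC.
Qed.

Lemma tevalZ I (A : {set I}) (i : I) (v : I -> X) a u : i \in A ->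
  teval A (dfwith v i (a *: u)) = a *: teval A (dfwith v i u).
Proof.
move=> iA; have eval0 : teval A (dfwith v i 0) = 0.
  by rewrite -(subrr 0) tevalB // subrr.
by rewrite -[a *: u in LHS]addr0 (teval_linear v iA) eval0 addr0.
Qed.

Lemma teval_scale I (A : {set I}) (c : I -> K) (v : I -> X) :
  teval A (fun i => c i *: v i) = (\prod_(i in A) c i) *: teval A v.
Proof.
pose hybrid (s : seq I) i := if i \in s then c i *: v i else v i.
suff hyb s : uniq s -> {subset s <= A} ->
    teval A (hybrid s) = (\prod_(i <- s) c i) *: teval A v.
  have sA : {subset enum A <= A} by move=> i; rewrite mem_enum.
  rewrite -big_enum /= -(hyb _ (enum_uniq _) sA).
  by apply: eq_teval => i iA; rewrite /hybrid mem_enum iA.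
elim: s => [|i s IHs] /= => [_ _|/andP[iNs s_uniq] sA].
  by rewrite big_nil scale1r; apply: eq_teval.
have iA : i \in A by rewrite sA ?mem_head.
have -> : hybrid (i :: s) = dfwith (hybrid s) i (c i *: v i).
  apply/funext => k; have [<-|ik] := eqVneq i k.
    by rewrite dfwithin /hybrid mem_head.
  by rewrite dfwithout // /hybrid in_cons eq_sym (negbTE ik).
rewrite tevalZ // big_cons -scalerA -IHs // => [|k ks]; last first.
  by rewrite sA // in_cons ks orbT.
congr (_ *: _); apply: eq_teval => k _; have [<-|ik] := eqVneq i k.
  by rewrite dfwithin /hybrid (negbTE iNs).
by rewrite dfwithout.
Qed.

(** Normalize each argument; with [0^-1 = 0] this needs no case distinction. *)
Lemma teval_bounded I (A : {set I}) : exists2 M : K, 0 < M &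
  forall v : I -> X, `|teval A v| <= M * \prod_(i in A) `|v i|.
Proof.
have [M TM] := symop_bounded (T #|A|).
have M0 : 0 <= M.
  by apply: le_trans (TM (fun=> 0) _) => // i; rewrite normr0.
exists (M + 1) => [|v]; first by rewrite ltr_wpDl.
pose u i := `|v i|^-1 *: v i.
have -> : teval A v = (\prod_(i in A) `|v i|) *: teval A u.
  rewrite -teval_scale; apply: eq_teval => i _; rewrite scalerA.
  have [->|vi0] := eqVneq (v i) 0; first by rewrite scaler0.
  by rewrite divff ?scale1r ?normr_eq0.
rewrite normrZ mulrC ger0_norm ?prodr_ge0 //.
apply: ler_wpM2r; first exact: prodr_ge0.
apply: ler_wpDr => //; rewrite tevalE; apply: TM => k.
rewrite normrZ normfV normr_id.
by have [->|vi0] := eqVneq (`|v (enum_val k)|) 0; rewrite ?mulr0 ?mulVf.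
Qed.

End Evaluation.

(** * Asymptotic estimates along a filter *)

Section Asymptotics.
Variables (K : numFieldType) (W : Type) (F : set_system W).
Context {FF : Filter F}.
Implicit Types (V : normedModType K) (b : W -> K).

(** This is [r = o(b)] along [F], and [dominated r b] is [r = O(b)]. The
    comparison function [b] is meant to be non-negative and enters without its
    norm. *)
Definition negligible V (r : W -> V) b :=
  forall e : K, 0 < e -> \forall z \near F, `|r z| <= e * b z.

Definition dominated V (r : W -> V) b :=
  exists2 M : K, 0 < M & \forall z \near F, `|r z| <= M * b z.

Lemma negligible_dominated V (r : W -> V) b : negligible r b -> dominated r b.
Proof. by move=> r_b; exists 1 => //; apply: r_b. Qed.

Lemma eq_negligible V (r r' : W -> V) b :
  negligible r b -> (forall z, r z = r' z) -> negligible r' b.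
Proof. by move=> r_b rr' e e0; apply: filterS (r_b e e0) => z; rewrite rr'. Qed.

Lemma eq_dominated V (r r' : W -> V) b :
  dominated r b -> (forall z, r z = r' z) -> dominated r' b.
Proof.
by move=> [M M0 rM] rr'; exists M => //; apply: filterS rM => z; rewrite rr'.
Qed.

Lemma negligible0 V b : (forall z, 0 <= b z) -> negligible (fun=> 0 : V) b.
Proof.
by move=> b0 e e0; apply: nearW => z; rewrite normr0 mulr_ge0 // ltW.
Qed.

Lemma negligibleD V (r r' : W -> V) b :
  negligible r b -> negligible r' b -> negligible (fun z => r z + r' z) b.
Proof.
move=> r_b r'_b e e0; have e20 : 0 < e / 2 by rewrite divr_gt0.
apply: filterS2 (r_b _ e20) (r'_b _ e20) => z rz r'z.
rewrite (le_trans (ler_normD _ _)) // [leRHS](_ : _ = e / 2 * b z + e / 2 * b z).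
  exact: lerD.
by rewrite -mulrDl -splitr.
Qed.

Lemma negligibleN V (r : W -> V) b :
  negligible r b -> negligible (fun z => - r z) b.
Proof. by move=> r_b e e0; apply: filterS (r_b e e0) => z; rewrite normrN. Qed.

Lemma negligible_sum V (J : finType) (P : pred J) (r : J -> W -> V) b :
  (forall z, 0 <= b z) -> (forall j, P j -> negligible (r j) b) ->
  negligible (fun z => \sum_(j | P j) r j z) b.
Proof.
move=> b0 r_b; rewrite -fct_sumE.
by apply: (big_ind (fun r => negligible r b)) => [|? ?|//];
  [exact: negligible0|exact: negligibleD].
Qed.

Lemma dominatedD V (r r' : W -> V) b :
  dominated r b -> dominated r' b -> dominated (fun z => r z + r' z) b.
Proof.
move=> [M M0 rM] [M' M'0 r'M']; exists (M + M'); first exact: addr_gt0.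
apply: filterS2 rM r'M' => z rz r'z.
by rewrite mulrDl (le_trans (ler_normD _ _)) ?lerD.
Qed.

(** The estimate [`|r z| <= e * b z] forces [0 <= b z], hence [`|b z| = b z]. *)
Lemma negligible_trans V (r : W -> V) b b' :
  negligible r b -> dominated b b' -> negligible r b'.
Proof.
move=> r_b [M M0 bM] e e0; have eM0 : 0 < e / M by rewrite divr_gt0.
apply: filterS2 (r_b _ eM0) bM => z rz bz; apply: (le_trans rz).
have bz0 : 0 <= b z.
  by rewrite -(pmulr_rge0 _ eM0) (le_trans _ rz).
have -> : e * b' z = e / M * (M * b' z) by rewrite mulrA divfK ?lt0r_neq0.
by rewrite ler_pM2l // -(ger0_norm bz0).
Qed.

Lemma dominated_trans V (r : W -> V) b b' :
  dominated r b -> dominated b b' -> dominated r b'.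
Proof.
move=> [M M0 rM] [M' M'0 bM']; exists (M * M'); first exact: mulr_gt0.
apply: filterS2 rM bM' => z rz bz; apply: (le_trans rz).
have bz0 : 0 <= b z by rewrite -(pmulr_rge0 _ M0) (le_trans _ rz).
by rewrite -mulrA ler_pM2l // -(ger0_norm bz0).
Qed.

Lemma dominated_negligible_trans V (r : W -> V) b b' :
  dominated r b -> negligible b b' -> negligible r b'.
Proof.
move=> [M M0 rM] b_b' e e0; have eM0 : 0 < e / M by rewrite divr_gt0.
apply: filterS2 rM (b_b' _ eM0) => z rz bz; apply: (le_trans rz).
have bz0 : 0 <= b z by rewrite -(pmulr_rge0 _ M0) (le_trans _ rz).
have -> : e * b' z = M * (e / M * b' z).
  by rewrite mulrA [M * (e / M)]mulrC divfK ?lt0r_neq0.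
by rewrite ler_pM2l // -(ger0_norm bz0).
Qed.

Lemma dominated_prod V (J : finType) (A : {set J}) (r : J -> W -> V)
    (b : J -> W -> K) :
  (forall j, j \in A -> dominated (r j) (b j)) ->
  dominated (fun z => \prod_(j in A) `|r j z|) (fun z => \prod_(j in A) b j z).
Proof.
move=> r_b.
have /choice[M MP] : forall j, exists M : K, 0 < M /\
    (j \in A -> \forall z \near F, `|r j z| <= M * b j z).
  move=> j; have [/r_b[M M0 rM]|] := boolP (j \in A); first by exists M.
  by exists 1.
exists (\prod_(j in A) M j); first by apply: prodr_gt0 => j _; case: (MP j).
have : \forall z \near F, forall j, j \in A -> `|r j z| <= M j * b j z.
  apply: filter_forall => j; have [jA|jA] := boolP (j \in A).
    by apply: filterS (proj2 (MP j) jA).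
  exact: nearW.
apply: filterS => z rz; rewrite -big_split /= ger0_norm ?prodr_ge0 //.
by apply: ler_prod => j jA; rewrite normr_ge0 rz.
Qed.

Lemma negligible_mul (r r' : W -> K) b b' :
  negligible r b -> dominated r' b' ->
  negligible (fun z => r z * r' z) (fun z => b z * b' z).
Proof.
move=> r_b [M M0 r'M] e e0; have eM0 : 0 < e / M by rewrite divr_gt0.
apply: filterS2 (r_b _ eM0) r'M => z rz r'z; rewrite normrM.
by rewrite -[e in leRHS](divfK (lt0r_neq0 M0)) mulrACA ler_pM.
Qed.

Lemma negligible_norm V (r : W -> V) b :
  negligible r b -> negligible (fun z => `|r z|) b.
Proof. by move=> r_b e e0; apply: filterS (r_b e e0) => z; rewrite normr_id. Qed.

Lemma negligible_prod V (J : finType) (A : {set J}) (j0 : J)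
    (r : J -> W -> V) (b : J -> W -> K) :
  j0 \in A -> negligible (r j0) (b j0) ->
  (forall j, j \in A -> dominated (r j) (b j)) ->
  negligible (fun z => \prod_(j in A) `|r j z|) (fun z => \prod_(j in A) b j z).
Proof.
move=> j0A r0 r_b.
have rA : dominated (fun z => \prod_(j in (A :\ j0)%SET) `|r j z|)
                    (fun z => \prod_(j in (A :\ j0)%SET) b j z).
  by apply: dominated_prod => j; rewrite inE => /andP[_ /r_b].
move=> e e0; apply: filterS (negligible_mul (negligible_norm r0) rA e0) => z.
by rewrite -!(finset.big_setD1 j0).
Qed.

(** Replace the arguments [l j] by [a j] one at a time: each step changes the
    value by a term whose [j]-th argument is the negligible [a j - l j]. *)
Lemma teval_negligible (X Y : normedModType K) (T : forall k, symop k X Y)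
    (J : finType) (A : {set J}) (a l : W -> J -> X) (b : J -> W -> K) :
  (forall z, 0 <= \prod_(j in A) b j z) ->
  (forall j, j \in A -> dominated (fun z => l z j) (b j)) ->
  (forall j, j \in A -> negligible (fun z => a z j - l z j) (b j)) ->
  negligible (fun z => teval T A (a z) - teval T A (l z))
             (fun z => \prod_(j in A) b j z).
Proof.
move=> b0 l_b al_b.
have a_b j : j \in A -> dominated (fun z => a z j) (b j).
  move=> jA; apply: (eq_dominated (dominatedD
    (negligible_dominated (al_b j jA)) (l_b j jA))) => z.
  exact: subrK.
pose hybrid (s : seq J) z j := if j \in s then a z j else l z j.
suff hyb s : uniq s -> {subset s <= A} ->
    negligible (fun z => teval T A (hybrid s z) - teval T A (l z))
               (fun z => \prod_(j in A) b j z).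
  have sA : {subset enum A <= A} by move=> j; rewrite mem_enum.
  apply: (eq_negligible (hyb _ (enum_uniq _) sA)) => z.
  by congr (_ - _); apply: eq_teval => j jA; rewrite /hybrid mem_enum jA.
elim: s => [|j s IHs] /= => [_ _|/andP[jNs s_uniq] sA].
  apply: (eq_negligible (negligible0 _ b0)) => z.
  by rewrite (_ : teval T A (hybrid [::] z) = teval T A (l z)) ?subrr.
have jA : j \in A by rewrite sA ?mem_head.
have {}IHs := IHs s_uniq (fun k ks => sA k (mem_behead (s := j :: s) ks)).
pose step z := dfwith (hybrid s z) j (a z j - l z j).
have stepE z : teval T A (step z) =
    teval T A (hybrid (j :: s) z) - teval T A (hybrid s z).
  rewrite /step tevalB //; congr (teval T A _ - teval T A _).
    apply/funext => k; have [<-|jk] := eqVneq j k.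
      by rewrite dfwithin /hybrid mem_head.
    by rewrite dfwithout // /hybrid in_cons eq_sym (negbTE jk).
  apply/funext => k; have [<-|jk] := eqVneq j k.
    by rewrite dfwithin /hybrid (negbTE jNs).
  by rewrite dfwithout.
suff step_b : negligible (fun z => teval T A (step z))
                         (fun z => \prod_(j in A) b j z).
  apply: (eq_negligible (negligibleD step_b IHs)) => z.
  by rewrite stepE addrA subrK.
have [M M0 TM] := teval_bounded T A.
have step_prod : negligible (fun z => \prod_(k in A) `|step z k|)
                            (fun z => \prod_(j in A) b j z).
  apply: (@negligible_prod _ _ _ j) => // [|k kA].
    by apply: (eq_negligible (al_b j jA)) => z; rewrite /step dfwithin.
  have [<-|jk] := eqVneq j k.
    apply: (eq_dominated (negligible_dominated (al_b j jA))) => z.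
    by rewrite /step dfwithin.
  have [ks|kNs] := boolP (k \in s).
    apply: (eq_dominated (a_b k kA)) => z.
    by rewrite /step dfwithout // /hybrid ks.
  apply: (eq_dominated (l_b k kA)) => z.
  by rewrite /step dfwithout // /hybrid (negbTE kNs).
move=> e e0; have eM0 : 0 < e / M by rewrite divr_gt0.
apply: filterS (step_prod _ eM0) => z; rewrite ger0_norm ?prodr_ge0 //.
rewrite -(ler_pM2l M0) mulrA [M * (e / M)]mulrC divfK ?lt0r_neq0 //.
exact: le_trans.
Qed.

End Asymptotics.

(** * Strict derivatives as estimates on differences *)

(** Base points tending to [x] together with steps tending to [0]: the mode of
    convergence in the definition of a strict derivative. *)
Definition near_base (K : numFieldType) (X : normedModType K) (x : X)
    (I : finType) : set_system (X * (I -> X)) :=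
  filter_from [set d : K | 0 < d]
    (fun d => [set z | `|z.1 - x| < d /\ forall i, `|z.2 i| < d]).
Arguments near_base {K X} x I.

Section NearBase.
Variables (K : numFieldType).

Global Instance near_base_filter (X : normedModType K) (x : X) (I : finType) :
  Filter (near_base x I).
Proof.
apply: filter_from_filter => [|d d' d0 d'0]; first by exists 1 => /=.
have dd' : (d >=< d')%O by rewrite real_comparable // gtr0_real.
exists (Num.min d d') => [/=|z /=]; first by rewrite comparable_lt_min ?d0.
rewrite comparable_lt_min // => -[/andP[xd xd'] vdd'].
by split; split=> // i; move: (vdd' i); rewrite comparable_lt_min // => /andP[].
Qed.

Lemma near_base_point (X : normedModType K) (x : X) (I : finType) (e : K) :
  0 < e -> \forall z \near near_base x I, `|z.1 - x| < e.
Proof. by move=> e0; exists e => //= z []. Qed.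

Lemma near_base_step (X : normedModType K) (x : X) (I : finType) (i : I) (e : K) :
  0 < e -> \forall z \near near_base x I, `|z.2 i| < e.
Proof. by move=> e0; exists e => //= z []. Qed.

Lemma cvg_near_base (W : Type) (F : set_system W) {FF : Filter F}
    (X : normedModType K) (x : X) (I : finType) (phi : W -> X * (I -> X)) :
  (forall e, 0 < e -> \forall z \near F, `|(phi z).1 - x| < e) ->
  (forall i e, 0 < e -> \forall z \near F, `|(phi z).2 i| < e) ->
  phi @ F --> near_base x I.
Proof.
move=> phi1 phi2 P [d d0 dP].
have phi2d : \forall z \near F, forall i, `|(phi z).2 i| < d.
  by apply: filter_forall => i; apply: phi2.
change (F (phi @^-1` P)); apply: filterS2 (phi1 _ d0) phi2d => z z1 z2.
exact: dP.
Qed.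

Lemma negligible_comp (W W' : Type) (F : set_system W) (G : set_system W')
    (V : normedModType K) (r : W' -> V) (b : W' -> K) (phi : W -> W') :
  phi @ F --> G -> negligible G r b -> negligible F (r \o phi) (b \o phi).
Proof. by move=> phiG r_b e e0; apply: phiG (r_b e e0). Qed.

(** Transfers differences between subsets of arbitrary index types and the
    standard index types that occur in [is_strict_derivative]. *)
Lemma diff_enum (X : zmodType) (Y : lmodType K) (I : finType) (f : X -> Y)
    (A : {set I}) w (v : I -> X) :
  diff f A w v =
    diff f [set: 'I_#|A|]%SET w (fun j => v (enum_val j)).
Proof.
have enumA : enum_val @: [set: 'I_#|A|]%SET = A.
  apply/setP => i; apply/imsetP/idP => [[j _ ->]|iA]; first exact: enum_valP.
  by exists (enum_rank_in iA i); rewrite ?inE ?enum_rankK_in.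
have inj := @enum_val_inj _ (mem A).
rewrite /diff /altsum.
rewrite (reindex_onto (fun S : {set 'I_#|A|} => enum_val @: S)
                      (fun S : {set I} => enum_val @^-1: S)) /=.
  apply: eq_big => [S|S _].
    have -> : [set enum_val j | j in S]%SET \subset A.
      by apply/fintype.subsetP => _ /imsetP[j _ ->]; apply: enum_valP.
    rewrite finset.subsetT; apply/eqP/setP => j.
    by rewrite inE mem_imset.
  congr (_ ^+ _ *: f (_ + _)); last by rewrite big_imset //= => ? ? _ _ /inj.
  rewrite -(card_imset (mem (_ :\: S)%SET) inj); congr #|pred_of_set _|.
  apply/setP => i; apply/finset.setDP/imsetP => [[iA iS]|[j + ->]].
    exists (enum_rank_in iA i); rewrite ?enum_rankK_in // !inE andbT.
    by apply: contra iS => jS; apply/imsetP; exists (enum_rank_in iA i);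
      rewrite ?enum_rankK_in.
  by rewrite !inE andbT mem_imset // => jS; rewrite enum_valP.
move=> S SA; apply/setP => i; apply/imsetP/idP => [[j]|iS].
  by rewrite inE => + ->.
have iA := fintype.subsetP SA i iS.
by exists (enum_rank_in iA i); rewrite ?inE enum_rankK_in.
Qed.

Lemma diff_setT (X : zmodType) (Y : lmodType K) n (f : X -> Y) w
    (v : 'I_n -> X) :
  diff f [set: 'I_n]%SET w v =
  \sum_(S : {set 'I_n}) (-1) ^+ (n - #|S|) *: f (w + \sum_(i in S) v i).
Proof.
rewrite /diff /altsum; apply: eq_big => S; first by rewrite finset.subsetT.
by rewrite cardsDS ?finset.subsetT // cardsT card_ord.
Qed.

Lemma strict_derivative_diff (X Y : normedModType K) (U : set X) (f : X -> Y)
    (x : X) (T : forall k, symop k X Y) (I : finType) (A : {set I}) :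
  is_strict_derivative U f x (T #|A|) ->
  negligible (near_base x I) (fun z => diff f A z.1 z.2 - teval T A z.2)
    (fun z => \prod_(i in A) `|z.2 i|).
Proof.
move=> [_ fT] e e0; have [d d0 dT] := fT e e0.
exists d => //= -[w v] /= [wd vd]; rewrite diff_enum diff_setT tevalE.
rewrite (le_trans (dT w (fun j => v (enum_val j)) _ _)) //.
by rewrite ler_pM2l // [leRHS]big_enum_val.
Qed.

(** At order [0] the difference is the value itself, and the operator is a
    constant approximated by [f] both near [x] and at [x]. *)
Lemma strict_derivative0_cvg (X Y : normedModType K) (U : set X) (f : X -> Y)
    (x : X) (T : symop 0 X Y) (I : finType) :
  is_strict_derivative U f x T ->
  forall e, 0 < e -> \forall z \near near_base x I, `|f z.1 - f x| < e.
Proof.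
move=> [_ fT] e e0; have e40 : 0 < e / 2 / 2 by rewrite !divr_gt0.
have [d d0 dT] := fT _ e40.
have near_T w : `|w - x| < d -> `|f w - T (fun=> x)| <= e / 2 / 2.
  move=> wd; have := dT w (fun=> x) wd; rewrite -diff_setT big_ord0 mulr1.
  have -> : [set: 'I_0]%SET = finset.set0 by apply/setP => -[].
  by rewrite diff0; apply => -[].
exists d => //= z [zd _]; have xd : `|x - x| < d by rewrite subrr normr0.
rewrite -[f z.1](subrK (T (fun=> x))) -addrA (le_lt_trans (ler_normD _ _)) //.
rewrite [`|T _ - _|]distrC (le_lt_trans (lerD (near_T _ zd) (near_T _ xd))) //.
by rewrite -splitr ltr_pdivrMr // mulr_natr mulr2n ltrDl.
Qed.

Lemma strict_derivativeP (X Y : normedModType K) (U : set X) (f : X -> Y)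
    (x : X) n (T : symop n X Y) :
  U° x ->
  negligible (near_base x 'I_n) (fun z => diff f [set: 'I_n]%SET z.1 z.2 - T z.2)
    (fun z => \prod_(i < n) `|z.2 i|) ->
  is_strict_derivative U f x T.
Proof.
move=> Ux fT; split=> // e e0; have [d d0 dT] := fT e e0; exists d => // w v wd vd.
by rewrite -diff_setT; apply: (dT (w, v)).
Qed.

(** Remove from [B] a point [b] outside [B']: the difference along [B] is the
    change of the difference along [B :\ b] when the base point moves by [z.2 b].
    When [B :\ b] is [B'], the main term [teval T B' z.2] is the same at both
    base points and cancels, leaving two remainders; otherwise both terms are
    negligible by induction. *)
Lemma diff_proper_negligible (Y Z : normedModType K) (g : Y -> Z) (y : Y)
    (T : forall k, symop k Y Z) (J : finType) (B' B : {set J}) :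
  B' \proper B ->
  negligible (near_base y J) (fun z => diff g B' z.1 z.2 - teval T B' z.2)
    (fun z => \prod_(j in B') `|z.2 j|) ->
  negligible (near_base y J) (fun z => diff g B z.1 z.2)
    (fun z => \prod_(j in B') `|z.2 j|).
Proof.
move=> B'B gB'.
pose shift b (z : Y * (J -> Y)) := (z.1 + z.2 b, z.2).
have shift_cvg b : shift b @ near_base y J --> near_base y J.
  apply: cvg_near_base => [e e0|j e e0] /=; last exact: near_base_step.
  have e20 : 0 < e / 2 by rewrite divr_gt0.
  apply: filterS2 (near_base_point y J e20) (near_base_step y b e20) => z z1 z2.
  by rewrite addrAC [e]splitr (le_lt_trans (ler_normD _ _)) // ltrD.
have [m] := ubnP #|B|; elim: m => // m IHm in B B'B *; rewrite ltnS => leBm.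
have /properP[sB'B [b bB bB']] := B'B.
have bC : b \notin B :\ b by rewrite finset.setD11.
have sB'C : B' \subset B :\ b by rewrite subsetD1 sB'B.
have diffB z : diff g B z.1 z.2 =
    diff g (B :\ b)%SET (shift b z).1 (shift b z).2 - diff g (B :\ b)%SET z.1 z.2.
  by rewrite -diffU1 // finset.setD1K.
have [eqB'C|neqB'C] := eqVneq B' (B :\ b)%SET.
  apply: (eq_negligible (negligibleD (negligible_comp (shift_cvg b) gB')
                                     (negligibleN gB'))) => z.
  by rewrite diffB -eqB'C /= opprB addrA subrK.
have B'C : B' \proper (B :\ b)%SET by rewrite finset.properEneq neqB'C.
have gC := IHm _ B'C (leq_trans (proper_card (finset.properD1 bB)) leBm).
apply: (eq_negligible (negligibleD (negligible_comp (shift_cvg b) gC)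
                                   (negligibleN gC))) => z.
by rewrite diffB.
Qed.

End NearBase.

(** * The sum over partitions as a symmetric operator *)

Section FaaDiBruno.
Import boot.fintype boot.finset.
Variables (K : numFieldType) (X Y Z : normedModType K).
Variables (Df : forall k, symop k X Y) (Dg : forall k, symop k Y Z).
Implicit Types (I J : finType).

Definition partition_term I (v : I -> X) (P : {set {set I}}) : Z :=
  teval Dg P (fun S : {set I} => teval Df S v).

Definition partition_sum I (v : I -> X) : Z :=
  \sum_(P : {set {set I}} | partition P [set: I]) partition_term v P.

(** A bijection of the index types induces one of their partitions; this yields
    both the symmetry of the operator and its value on families indexed by an
    arbitrary finite type. *)
Lemma partition_sum_bij I J (h : J -> I) (v : I -> X) :
  bijective h -> partition_sum v = partition_sum (v \o h).
Proof.
move=> [h' hK h'K]; have h_inj := can_inj hK.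
have hT : h @: [set: J] = [set: I].
  by apply/setP => i; rewrite inE; apply/imsetP; exists (h' i).
have imK : cancel (fun S : {set J} => h @: S) (fun S : {set I} => h' @: S).
  by move=> S; rewrite -imset_comp (eq_imset _ hK) imset_id.
have imK' : cancel (fun S : {set I} => h' @: S) (fun S : {set J} => h @: S).
  by move=> S; rewrite -imset_comp (eq_imset _ h'K) imset_id.
rewrite /partition_sum.
rewrite (reindex_onto
  (fun Q : {set {set J}} => (fun S : {set J} => h @: S) @: Q)
  (fun P : {set {set I}} => (fun S : {set I} => h' @: S) @: P)) /=; last first.
  by move=> P _; rewrite -imset_comp (eq_imset _ imK') imset_id.
apply: eq_big => [Q|Q _].
  rewrite -imset_comp (eq_imset _ imK) imset_id eqxx andbT.
  by rewrite -hT imset_partition.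
rewrite /partition_term teval_imset; last exact: can_inj imK.
by apply: eq_teval => S _ /=; rewrite teval_imset.
Qed.

(** The index [i] lies in exactly one block, so exactly one argument of the
    outer operator depends on [v i], and it does so linearly. *)
Lemma partition_term_linear I (v : I -> X) i (P : {set {set I}}) :
  partition P [set: I] -> linear (fun u => partition_term (dfwith v i u) P).
Proof.
move=> partP a u u'.
have iP : i \in cover P by rewrite (cover_partition partP) inE.
pose S0 := pblock P i.
have S0P : S0 \in P by apply: pblock_mem.
have iS0 : i \in S0 by rewrite mem_pblock.
have termE t : partition_term (dfwith v i t) P =
    teval Dg P (dfwith (fun S => teval Df S v) S0 (teval Df S0 (dfwith v i t))).
  apply: eq_teval => S SP; have [<-|S0S] := eqVneq S0 S; first by rewrite dfwithin.
  rewrite dfwithout //; apply: eq_teval => k kS; rewrite dfwithout //.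
  apply: contraNneq S0S => ik.
  by rewrite /S0 (def_pblock (partition_trivIset partP) SP) // ik.
by rewrite !termE teval_linear // teval_linear.
Qed.

Lemma partition_sum_linear I (v : I -> X) i :
  linear (fun u => partition_sum (dfwith v i u)).
Proof.
move=> a u u'; rewrite /partition_sum scaler_sumr -big_split /=.
by apply: eq_bigr => P partP; apply: partition_term_linear.
Qed.

Lemma partition_sum_bounded I : exists M : K, forall v : I -> X,
  (forall i, `|v i| <= 1) -> `|partition_sum v| <= M.
Proof.
have /choice[M MP] : forall P : {set {set I}}, exists M : K, forall v : I -> X,
    (forall i, `|v i| <= 1) -> `|partition_term v P| <= M.
  move=> P; have [M M0 DgM] := teval_bounded Dg P.
  have /choice[N NP] : forall S : {set I}, exists N : K, 0 < N /\
      forall v : I -> X, `|teval Df S v| <= N * \prod_(i in S) `|v i|.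
    by move=> S; have [N N0 DfN] := teval_bounded Df S; exists N.
  exists (M * \prod_(S in P) N S) => v v1.
  apply: le_trans (DgM _) _; rewrite ler_pM2l //; apply: ler_prod => S _.
  rewrite normr_ge0; have [N0 DfN] := NP S; apply: le_trans (DfN v) _.
  by rewrite ger_pMr // Num.Theory.prodr_ile1 // => i _; rewrite normr_ge0 v1.
exists (\sum_(P : {set {set I}} | partition P [set: I]) M P) => v v1.
by apply: le_trans (ler_norm_sum _ _ _) _; apply: ler_sum => P _; apply: MP.
Qed.

Lemma partition_sum_sym n (s : 'S_n) (v : 'I_n -> X) :
  partition_sum (v \o s) = partition_sum v.
Proof.
apply/esym/partition_sum_bij.
by exists (s^-1)%g => j; rewrite ?permK ?permKV.
Qed.

Definition faa_di_bruno n : symop n X Z :=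
  @SymOp K n X Z (@partition_sum 'I_n) (@partition_sum_linear 'I_n)
    (@partition_sum_sym n) (partition_sum_bounded 'I_n).

Lemma sym_eval_faa_di_bruno n I (cardI : #|[set: I]| = n) (v : I -> X) :
  sym_eval (faa_di_bruno n) cardI v = partition_sum v.
Proof.
apply/esym/partition_sum_bij.
exists (fun i => cast_ord cardI (enum_rank_in (in_setT i) i)) => [j|i].
  by apply: (cast_ord_inj (eq_n := esym cardI)); rewrite cast_ordK enum_valK_in.
by rewrite cast_ordK enum_rankK_in ?inE.
Qed.

End FaaDiBruno.

(** * Negligible contributions to the expansion of the composite *)

(** Regrouped by points, the left side is the product of the [c i ^+ m i] with
    [m i] the number of sets of [B] containing [i]. *)
Lemma prod_cover_le (K : numFieldType) (I : finType) (B : {set {set I}})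
    (c : I -> K) (e : I -> nat) :
  (forall i, 0 <= c i <= 1) ->
  (forall i, (e i <= #|[set T in B | i \in T]%SET|)%N) ->
  \prod_(T in B) \prod_(i in T) c i <= \prod_i c i ^+ e i.
Proof.
move=> c01 eB; rewrite (exchange_big_dep predT) //=.
apply: ler_prod => i _; have /andP[c0 c1] := c01 i.
rewrite prodr_const exprn_ge0 //=; apply: ler_wiXn2l => //.
by apply: leq_trans (eB i) _; rewrite cardsE.
Qed.

Section Composite.
Import boot.fintype boot.finset.
Variables (K : numFieldType) (X Y Z : normedModType K) (I : finType).
Variables (f : X -> Y) (g : Y -> Z) (x : X).
Variables (Df : forall k, symop k X Y) (Dg : forall k, symop k Y Z).

(* [increments f z.1 z.2] is a family of steps indexed by the subsets of [I], so
   the differences of [g] are taken along sets of subsets of [I]. *)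
Let Fx := near_base x I.
Let step_prod (T : {set I}) (z : X * (I -> X)) : K := \prod_(i in T) `|z.2 i|.
Let all_steps (z : X * (I -> X)) : K := \prod_i `|z.2 i|.
Let y (z : X * (I -> X)) : {set I} -> Y := increments f z.1 z.2.
Let phi (z : X * (I -> X)) := (f z.1, y z).

Hypothesis f_cont :
  forall e : K, 0 < e -> \forall z \near Fx, `|f z.1 - f x| < e.
Hypothesis f_diff : forall T : {set I},
  negligible Fx (fun z => diff f T z.1 z.2 - teval Df T z.2) (step_prod T).
Hypothesis g_diff : forall B : {set {set I}}, (#|B| <= #|I|)%N ->
  negligible (near_base (f x) {set I})
    (fun z => diff g B z.1 z.2 - teval Dg B z.2)
    (fun z => \prod_(T in B) `|z.2 T|).

Let step_prod_ge0 T z : 0 <= step_prod T z.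
Proof. exact: prodr_ge0. Qed.

Lemma teval_dominated T : dominated Fx (fun z => teval Df T z.2) (step_prod T).
Proof.
by have [M M0 MT] := teval_bounded Df T; exists M => //; apply: nearW => z; apply: MT.
Qed.

Lemma increments_dominated T : dominated Fx (fun z => y z T) (step_prod T).
Proof.
have [->|T0] := eqVneq T finset.set0.
  exists 1 => //; apply: nearW => z.
  by rewrite /y /increments eqxx normr0 mul1r.
apply: (eq_dominated (dominatedD
  (negligible_dominated (f_diff T)) (teval_dominated T))) => z.
by rewrite subrK /y /increments (negbTE T0).
Qed.

Lemma increments_cvg : phi @ Fx --> near_base (f x) {set I}.
Proof.
apply: cvg_near_base => [//|T e e0] /=.
have [->|[i iT]] := set_0Vmem T.
  by apply: nearW => z; rewrite /y /increments eqxx normr0.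
have [M M0 yM] := increments_dominated T.
have eM0 : 0 < e / M by rewrite divr_gt0.
have small1 : \forall z \near Fx, forall j, `|z.2 j| < 1.
  by apply: filter_forall => j; apply: near_base_step.
apply: filterS3 yM small1 (near_base_step x i eM0) => z yz z1 zi.
apply: le_lt_trans yz _; rewrite mulrC -ltr_pdivlMr //.
apply: le_lt_trans zi; rewrite /step_prod (finset.big_setD1 i) //=.
by rewrite ler_piMr // Num.Theory.prodr_ile1 // => j _; rewrite normr_ge0 ltW.
Qed.

Lemma diff_g_increments (B : {set {set I}}) : (#|B| <= #|I|)%N ->
  negligible Fx (fun z => diff g B (f z.1) (y z) - teval Dg B (y z))
    (fun z => \prod_(T in B) `|y z T|).
Proof. by move=> leBI; apply: (negligible_comp increments_cvg (g_diff leBI)). Qed.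

Lemma prod_increments_dominated (B : {set {set I}}) :
  dominated Fx (fun z => \prod_(T in B) `|y z T|)
    (fun z => \prod_(T in B) step_prod T z).
Proof. by apply: dominated_prod => T _; apply: increments_dominated. Qed.

Lemma small_steps : \forall z \near Fx, forall i, 0 <= `|z.2 i| <= 1.
Proof.
apply: filter_forall => i; apply: filterS (near_base_step x i ltr01) => z zi.
by rewrite normr_ge0 ltW.
Qed.

Lemma cover_card_gt0 (B : {set {set I}}) i :
  cover B = [set: I]%SET -> (0 < #|[set T in B | i \in T]%SET|)%N.
Proof.
move=> covB; have iB : i \in cover B by rewrite covB inE.
by apply/card_gt0P; exists (pblock B i); rewrite inE pblock_mem // mem_pblock.
Qed.

Lemma cover_dominated (B : {set {set I}}) : cover B = [set: I]%SET ->
  dominated Fx (fun z => \prod_(T in B) step_prod T z)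
    all_steps.
Proof.
move=> covB; exists 1 => //; apply: filterS small_steps => z z01.
rewrite mul1r ger0_norm ?prodr_ge0 //.
apply: le_trans (@prod_cover_le _ _ _ _ (fun=> 1%N) z01 _) _.
  by move=> i; apply: cover_card_gt0.
by apply: ler_prod => i _; rewrite expr1 normr_ge0 /=.
Qed.

(** A point [i0] shared by two sets of [B] contributes a second factor
    [`|z.2 i0|], which tends to [0]. *)
Lemma overlap_negligible (B : {set {set I}}) :
  cover B = [set: I]%SET -> ~~ trivIset B ->
  negligible Fx (fun z => \prod_(T in B) step_prod T z)
    all_steps.
Proof.
move=> covB ntrivB.
have [i0 i0B] : exists i0, (1 < #|[set T in B | i0 \in T]%SET|)%N.
  apply: contrapT => noi0; apply: (negP ntrivB); apply/trivIsetP => S T SB TB ST.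
  rewrite -finset.setI_eq0; apply/eqP/setP => i; rewrite !inE; apply/andP => -[iS iT].
  apply: noi0; exists i; apply/card_gt1P; exists S, T; split; rewrite ?inE //.
    by rewrite SB.
  by rewrite TB.
move=> e e0; apply: filterS2 small_steps (near_base_step x i0 e0) => z z01 zi0.
rewrite ger0_norm ?prodr_ge0 //.
apply: le_trans (@prod_cover_le _ _ _ _ (fun i => (i == i0).+1) z01 _) _.
  by move=> i; have [->//|_] := eqVneq i i0; apply: cover_card_gt0.
rewrite /all_steps [leLHS](bigD1 i0) //= [X in e * X](bigD1 i0) //= eqxx.
rewrite expr2 -!mulrA ler_pM //; [|exact: ltW|].
  by rewrite mulr_ge0 // prodr_ge0 // => i _; rewrite exprn_ge0.
rewrite ler_wpM2l //; apply: ler_prod => i /negbTE ->.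
by rewrite expr1 normr_ge0 /=.
Qed.

(** Choosing for each point of [I] one set of [B] containing it yields a subcover
    [B'] of at most [#|I|] sets, necessarily proper. *)
Lemma excess_negligible (B : {set {set I}}) :
  cover B = [set: I]%SET -> (#|I| < #|B|)%N ->
  negligible Fx (fun z => diff g B (f z.1) (y z)) all_steps.
Proof.
move=> covB ltIB; pose B' := pblock B @: [set: I]%SET.
have covI i : i \in cover B by rewrite covB inE.
have leB'I : (#|B'| <= #|I|)%N by rewrite -cardsT leq_imset_card.
have B'B : B' \proper B.
  rewrite properEcard (leq_ltn_trans leB'I ltIB) andbT.
  by apply/fintype.subsetP => _ /imsetP[i _ ->]; apply: pblock_mem.
have covB' : cover B' = [set: I]%SET.
  apply/setP => i; rewrite !inE; apply/bigcupP; exists (pblock B i).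
    exact: imset_f.
  by rewrite mem_pblock.
apply: negligible_trans (cover_dominated covB').
apply: negligible_trans (prod_increments_dominated B').
exact: (negligible_comp increments_cvg (diff_proper_negligible B'B (g_diff leB'I))).
Qed.

Lemma nonpartition_negligible (B : {set {set I}}) :
  cover B = [set: I]%SET -> ~~ trivIset B ->
  negligible Fx (fun z => diff g B (f z.1) (y z)) all_steps.
Proof.
move=> covB ntrivB; have [leBI|] := leqP #|B| #|I|; last exact: excess_negligible.
have diff_dom : dominated Fx (fun z => diff g B (f z.1) (y z))
    (fun z => \prod_(T in B) `|y z T|).
  have Dgy : dominated Fx (fun z => teval Dg B (y z))
      (fun z => \prod_(T in B) `|y z T|).
    have [M M0 MB] := teval_bounded Dg B.
    by exists M => //; apply: nearW => z; apply: MB.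
  apply: (eq_dominated (dominatedD
    (negligible_dominated (diff_g_increments leBI)) Dgy)) => z.
  exact: subrK.
apply: dominated_negligible_trans (overlap_negligible covB ntrivB).
exact: dominated_trans diff_dom (prod_increments_dominated B).
Qed.

(** Two replacements: the difference of [g] by the operator [Dg] applied to the
    increments, then the increments by their own main terms. *)
Lemma partition_negligible (B : {set {set I}}) :
  finset.partition B [set: I]%SET ->
  negligible Fx (fun z => diff g B (f z.1) (y z) - partition_term Df Dg z.2 B)
    all_steps.
Proof.
move=> partB; have covB := cover_partition partB.
have leBI : (#|B| <= #|I|)%N.
  rewrite -cardsT (card_partition partB) -sum1_card leq_sum // => T TB.
  by rewrite card_gt0 (partition_neq0 partB).
have outer : negligible Fx (fun z => diff g B (f z.1) (y z) - teval Dg B (y z))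
    (fun z => \prod_(T in B) step_prod T z).
  exact: negligible_trans (diff_g_increments leBI) (prod_increments_dominated B).
have inner : negligible Fx
    (fun z => teval Dg B (y z) - partition_term Df Dg z.2 B)
    (fun z => \prod_(T in B) step_prod T z).
  apply: teval_negligible => [z|T _|T TB].
  - by apply: prodr_ge0.
  - exact: teval_dominated.
  - apply: (eq_negligible (f_diff T)) => z.
    by rewrite /y /increments (negbTE (partition_neq0 partB TB)).
apply: negligible_trans (cover_dominated covB).
apply: (eq_negligible (negligibleD outer inner)) => z.
by rewrite addrA subrK.
Qed.

Lemma comp_negligible :
  negligible Fx
    (fun z => diff (g \o f) [set: I]%SET z.1 z.2 - partition_sum Df Dg z.2)
    all_steps.
Proof.
pose covers (B : {set {set I}}) :=
  (finset.set0 \notin B) && (cover B == [set: I]%SET).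
pose main (B : {set {set I}}) (z : X * (I -> X)) :=
  if trivIset B then partition_term Df Dg z.2 B else 0.
have part_covers B : finset.partition B [set: I]%SET = covers B && trivIset B.
  by rewrite /partition /covers [RHS]andbC [RHS]andbA [RHS]andbC.
have sumB : negligible Fx (fun z =>
    \sum_(B : {set {set I}} | covers B)
      (diff g B (f z.1) (y z) - main B z)) all_steps.
  apply: negligible_sum => [z|B covB]; first exact: prodr_ge0.
  have /andP[B0 /eqP covBT] := covB.
  have [trivB|trivB] := boolP (trivIset B).
    have partB : partition B [set: I] by rewrite part_covers covB.
    by apply: (eq_negligible (partition_negligible partB)) => z; rewrite /main trivB.
  apply: (eq_negligible (nonpartition_negligible covBT trivB)) => z.
  by rewrite /main (negbTE trivB) subr0.
apply: (eq_negligible sumB) => z.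
rewrite sumrB diff_comp; congr (_ - _).
by rewrite /partition_sum (eq_bigl _ _ part_covers) [RHS]big_mkcondr.
Qed.

End Composite.

(** * The chain rule *)

Theorem theorem1 (R : realType) (kind : scalar_kind) (n : nat)
    (X Y Z : completeNormedModType (scalars R kind))
    (U : set X) (V : set Y) (f : X -> Y) (g : Y -> Z) (x : X)
    (Df : forall k : nat, symop k X Y) (Dg : forall k : nat, symop k Y Z) :
  f @` U `<=` V ->
  U° x ->
  (forall k, (k <= n)%N -> is_strict_derivative U f x (Df k)) ->
  V (f x) ->
  (forall k, (k <= n)%N -> is_strict_derivative V g (f x) (Dg k)) ->
  exists2 D : symop n X Z,
    is_strict_derivative U (g \o f) x D &
    forall (I : finType) (cardI : #|[set: I]%SET| = n) (v : I -> X),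
      sym_eval D cardI v =
        \sum_(P : {set {set I}} | finset.partition P [set: I]%SET)
          sym_eval (Dg #|P|) (erefl #|P|)
            (fun S : {set I} => sym_eval (Df #|S|) (erefl #|S|) v).
Proof.
move=> _ Ux fD _ gD; exists (faa_di_bruno Df Dg n); last first.
  by move=> I cardI v; apply: sym_eval_faa_di_bruno.
have f_diff (T : {set 'I_n}) : negligible (near_base x 'I_n)
    (fun z => diff f T z.1 z.2 - teval Df T z.2)
    (fun z => \prod_(i in T) `|z.2 i|).
  apply: strict_derivative_diff; apply: fD.
  by rewrite -[leqRHS]card_ord max_card.
apply: strict_derivativeP => //; apply: comp_negligible => // [e e0|B leBI].
  exact: strict_derivative0_cvg (fD 0%N _) _ e0.
by apply: strict_derivative_diff; apply: gD; rewrite card_ord in leBI.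
Qed.
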